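(* Let $d\geq 2$, let $p\equiv 1\pmod d$ be a prime, and let $q$ be a power of $p$ such that $\frac{q-1}{d}\geq 3$. Assume that $A\subset\mathbb{F}_q$ satisfies $A\hat{+}A=S_d$. If $|A|$ is odd or $0\in A$, then $A$ is a Sidon set, $\{2a: a\in A\}\cap S_d=\emptyset$, and $$q=\frac{d|A|(|A|-1)}{2}+1.$$ If $|A|$ is even, then $$|A|=2\left\lceil\sqrt{\frac{q-1}{2d}}\right\rceil,$$ and the fractional part of $\sqrt{\frac{q-1}{2d}}$ lies in the open interval $\left(\frac12,\frac34\right)$.
   Context: $S_d=\{x^d: x\in\mathbb{F}_q^*\}$, the subgroup of $\mathbb{F}_q^*$ of order $\frac{q-1}{d}$. For $A\subset\mathbb{F}_q$, $A\hat{+}A=\{a+b: a,b\in A,\ a\neq b\}$. A set $A=\{a_1,\dots,a_N\}\subset\mathbb{F}_q$ is a Sidon set if all sums $a_i+a_j$ with $i\le j$ are distinct. *)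

(* Defs.v *)
From HB Require Import structures.
From mathcomp Require Export all_boot all_order all_algebra.
From mathcomp Require Export reals.

Set Implicit Arguments.
Unset Strict Implicit.
Unset Printing Implicit Defensive.

Import Order.TTheory GRing.Theory Num.Theory.
Local Open Scope ring_scope.

Definition power_residues (F : finFieldType) (d : nat) : {set F} :=
  [set x ^+ d | x in [set y : F | y != 0]].

Definition restricted_sumset (F : finFieldType) (A : {set F}) : {set F} :=
  [set a + b | a in A, b in A & a != b].

(* A = {a_1, ..., a_N} is listed without repetition by [enum_val]; the sums
   a_i + a_j over index pairs i <= j are pairwise distinct. *)
Definition sidon (F : finFieldType) (A : {set F}) : Prop :=
  forall i j k l : 'I_#|A|, (i <= j)%N -> (k <= l)%N ->
    enum_val i + enum_val j = enum_val k + enum_val l -> i = k /\ j = l.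

Definition frac_part (R : realType) (x : R) : R := x - (Num.floor x)%:~R.

(* Main.v *)
(** Put [n = (q - 1) / d] and [N = #|A|].  Counting pairs gives [n <= 'C(N, 2)].
    For the reverse bounds take [B \subset A] of size [2 m + 1], let [c_b] be the
    weights of the divided difference on [B], and consider, following Stepanov,
<<
    f(x) = \sum_(b in B) c_b (x + b)^(n + m) (x - b)^m.
>>
    Since divided differences kill degree [< 2 m], [f] has degree at most [n].
    Since [(a + b)^n = 1] for distinct [a, b] in [A], [f - (-1)^m] vanishes at
    every [a] in [A] to order [m], and to order [m + 1] if [a] is outside [B], if
    [a = 0] or if [2 a] is in [S_d]; at [0], if it is in [A] but not in [B], the
    order is [2 m + 1].  At a point [b] of [B] with [2 b] outside [S_d] and [0]
    the [m]-th Taylor coefficient is [c_b (2 b)^m ((2 b)^n - 1) <> 0], so this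
    polynomial is nonzero and its roots may be counted; [B] is [A], [A] minus
    [0], or [A] minus a point, according to the case.

    Such a [b] exists: otherwise the same count for
    [\sum_(b in B) c_b (x + b)^(n + s) - 1] with [#|B| = s + 1], whose [x^n]
    coefficient is ['C(n + s, n)], gives [N (s + 1) <= n + 1], which is absurd as
    soon as [s >= (N - 1) / 2].  All base-[p] digits of [n] are [(p - 1) / d], so
    some [s] between [(N - 1) / 2] and [N - 1] can be added to [n] without
    carries, which makes the binomial coefficient nonzero modulo [p]. *)

Require Import Defs.
From mathcomp Require Import all_boot all_order all_algebra.
From mathcomp Require Import all_field zify ring lra.
From mathcomp Require Import reals.

Import Order.TTheory GRing.Theory Num.Theory.
Local Open Scope ring_scope.

(** * Divided differences and multiplicities of roots *)

Lemma coef_XaddC_exp (R : comNzRingType) (u : R) (M l : nat) :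
  (('X + u%:P) ^+ M)`_l = u ^+ (M - l) *+ 'C(M, l).
Proof.
rewrite addrC exprDn coef_sum.
have E (i : 'I_M.+1) : (u%:P ^+ (M - i) * 'X ^+ i *+ 'C(M, i))`_l =
    if i == l :> nat then u ^+ (M - l) *+ 'C(M, l) else 0.
  rewrite coefMn -rmorphXn coefCM coefXn eq_sym.
  by case: eqP => [->|_]; rewrite ?mulr1 // mulr0 mul0rn.
rewrite (eq_bigr _ (fun i _ => E i)) -big_mkcond /=.
have [lM | Ml] := leqP l M; last first.
  by rewrite bin_small // mulr0n big1.
by rewrite (big_pred1 (Ordinal (lM : (l < M.+1)%N))).
Qed.

Lemma coef_XaddC_expM (R : comNzRingType) (u v : R) (M t k : nat) :
  (('X + u%:P) ^+ M * ('X + v%:P) ^+ t)`_k =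
  \sum_(l < k.+1) u ^+ (M - l) * v ^+ (t - (k - l)) *+ ('C(M, l) * 'C(t, k - l)).
Proof.
rewrite coefM; apply: eq_bigr => l _.
by rewrite !coef_XaddC_exp mulrnAl mulrnAr -mulrnA mulnC.
Qed.

Definition newton_weight (F : finFieldType) (B : {set F}) (b : F) : F :=
  (\prod_(a in B :\ b) (b - a))^-1.

Lemma newton_weight_neq0 (F : finFieldType) (B : {set F}) (b : F) :
  newton_weight F B b != 0.
Proof.
rewrite invr_eq0; apply/prodf_neq0 => a; rewrite !inE => /andP[ab _].
by rewrite subr_eq0 eq_sym.
Qed.

(** [P] is the Lagrange interpolant of [Q] on [B]. Both have size at most [#|B|], so they coincide,
    and each [l b] is monic of degree [#|B| - 1]. *)
Lemma divided_difference (F : finFieldType) (B : {set F}) (Q : {poly F}) :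
  (size Q <= #|B|)%N ->
  \sum_(b in B) newton_weight F B b * Q.[b] = Q`_(#|B|.-1).
Proof.
move=> szQ.
pose l (b : F) := \prod_(a in B :\ b) ('X - a%:P).
have sl b : b \in B -> size (l b) = #|B|.
  by move=> bB; rewrite /l -big_enum /= size_prod_XsubC -cardE (cardsD1 b B) bB.
have cl b : b \in B -> (l b)`_(#|B|.-1) = 1.
  by move=> bB; rewrite -(sl b bB) -lead_coefE; apply/eqP/monic_prod_XsubC.
pose P := \sum_(b in B) (newton_weight F B b * Q.[b]) *: l b.
suff -> : Q`_(#|B|.-1) = P`_(#|B|.-1).
  rewrite coef_sum; apply: eq_bigr => b bB.
  by rewrite coefZ cl // mulr1.
congr (_`_ _); congr polyseq; apply/eqP; rewrite -subr_eq0; apply/eqP.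
apply: (@roots_geq_poly_eq0 _ _ (enum B)); last 2 first.
- exact: enum_uniq.
- rewrite -cardE; apply: leq_trans (size_polyD _ _) _.
  rewrite geq_max szQ size_polyN.
  apply: leq_trans (size_sum _ _ _) _; apply/bigmax_leqP => b bB.
  by rewrite -(sl b bB) size_scale_leq.
apply/allP => c; rewrite mem_enum => cB.
rewrite rootE hornerD hornerN horner_sum (bigD1 c) //=.
rewrite big1 ?addr0 => [|b /andP[bB bc]]; last first.
  rewrite hornerZ horner_prod (bigD1 c) /=; last by rewrite !inE eq_sym bc.
  by rewrite hornerXsubC subrr mul0r mulr0.
rewrite hornerZ horner_prod (eq_bigr (fun a => c - a)) => [|a _]; last first.
  by rewrite hornerXsubC.
rewrite mulrAC mulVf ?mul1r ?subrr //.
by rewrite -invr_eq0 newton_weight_neq0.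
Qed.

Lemma dvdp_XsubC_exp (F : fieldType) (g : {poly F}) (a : F) (k : nat) :
  (forall i, (i < k)%N -> (g \Po ('X + a%:P))`_i = 0) -> ('X - a%:P) ^+ k %| g.
Proof.
move=> H; have : 'X^k %| g \Po ('X + a%:P).
  rewrite -[X in _ %| X](poly_take_drop k) (_ : take_poly _ _ = 0).
    by rewrite add0r dvdp_mull.
  by apply/polyP => i; rewrite coef_take_poly coef0; case: ifP => // /H.
by move/(dvdp_comp_poly ('X - a%:P)); rewrite comp_Xn_poly comp_polyXaddC_K.
Qed.

(** Powers of distinct linear factors are coprime, so their product divides [g]. *)
Lemma sum_multiplicities_lt_size (F : finFieldType) (g : {poly F})
    (A : {set F}) (mu : F -> nat) : g != 0 ->
  (forall a i, a \in A -> (i < mu a)%N -> (g \Po ('X + a%:P))`_i = 0) ->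
  (\sum_(a in A) mu a < size g)%N.
Proof.
move=> g0 H.
have D a : a \in A -> ('X - a%:P) ^+ mu a %| g.
  by move=> aA; apply: dvdp_XsubC_exp => i; apply: H.
have szP (s : seq F) : size (\prod_(a <- s) ('X - a%:P) ^+ mu a)
    = (\sum_(a <- s) mu a).+1.
  elim: s => [|a s IH]; first by rewrite !big_nil size_poly1.
  rewrite !big_cons size_Mmonic; last 2 first.
  - by rewrite expf_neq0 // polyXsubC_eq0.
  - by apply: monic_prod => b _; rewrite monic_exp ?monicXsubC.
  by rewrite size_exp_XsubC IH addnS.
rewrite -big_enum /= -szP; apply: dvdp_leq => //.
have: uniq (enum A) := enum_uniq A.
have: {subset enum A <= A} by move=> a; rewrite mem_enum.
elim: (enum A) => [|a s IH] sA /=; first by rewrite big_nil dvd1p.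
move=> /andP[as_ us]; rewrite big_cons Gauss_dvdp.
  rewrite D ?sA ?mem_head //= IH // => b bs.
  by apply: sA; rewrite inE bs orbT.
apply: coprimep_expl; rewrite coprimep_sym coprimep_XsubC.
apply: contra as_; rewrite rootE horner_prod prodf_seq_eq0 => /hasP[b bs /=].
rewrite horner_exp hornerXsubC expf_eq0 subr_eq0 => /andP[_ /eqP->].
by [].
Qed.

(** * Stepanov polynomials *)

Lemma newton_weight_exp (F : finFieldType) (B : {set F}) (e : nat) :
  (e < #|B|)%N ->
  \sum_(b in B) newton_weight F B b * b ^+ e = (e == #|B|.-1)%:R.
Proof.
move=> eB; have := @divided_difference F B 'X^e; rewrite size_polyXn coefXn.
rewrite eq_sym => <- //; apply: eq_bigr => b _.
by rewrite hornerXn.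
Qed.

Definition stepanov_poly (F : finFieldType) (B : {set F}) (M t : nat) : {poly F} :=
  \sum_(b in B) newton_weight F B b *: (('X + b%:P) ^+ M * ('X - b%:P) ^+ t).

(** The product is homogeneous of degree [M + t] in [X] and [b]. *)
Lemma coef_XaddC_XsubC_exp (F : comNzRingType) (b : F) (M t j : nat) :
  (('X + b%:P) ^+ M * ('X - b%:P) ^+ t)`_j =
  (('X + 1) ^+ M * ('X - 1) ^+ t : {poly F})`_j * b ^+ (M + t - j).
Proof.
rewrite -polyCN -['X - 1]/('X - 1%:P) -(polyCN 1) !coef_XaddC_expM mulr_suml.
apply: eq_bigr => l _; rewrite expr1n mul1r mulrnAl.
(* Outside these ranges the truncated exponents need not add up, but a binomial coefficient is
   zero. *)
have [Ml|lM] := ltnP M l; first by rewrite bin_small // mul0n.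
have [tj|jt] := ltnP t (j - l); first by rewrite (bin_small tj) muln0.
congr (_ *+ _); rewrite exprNn mulrCA -exprD.
congr (_ * b ^+ _); have := ltn_ord l; lia.
Qed.

Lemma coef_stepanov_poly (F : finFieldType) (B : {set F}) (M t j : nat) :
  (stepanov_poly F B M t)`_j =
  (('X + 1) ^+ M * ('X - 1) ^+ t : {poly F})`_j *
  \sum_(b in B) newton_weight F B b * b ^+ (M + t - j).
Proof.
rewrite coef_sum mulr_sumr; apply: eq_bigr => b _.
by rewrite coefZ coef_XaddC_XsubC_exp mulrCA.
Qed.

(** For [j > n] the weights meet a power of [b] below [s + t], hence sum to zero; [0 < s + t] covers
    exponents truncated to 0. *)
Lemma size_stepanov_poly (F : finFieldType) (B : {set F}) (n s t : nat) :
  (0 < s + t)%N -> #|B| = (s + t).+1 ->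
  (size (stepanov_poly F B (n + s) t) <= n.+1)%N.
Proof.
move=> st0 cB; apply/leq_sizeP => j nj.
rewrite coef_stepanov_poly newton_weight_exp cB; last by lia.
by rewrite (_ : _ == _ = false) ?mulr0 //; lia.
Qed.

Lemma coef_stepanov_poly_top (F : finFieldType) (B : {set F}) (n s : nat) :
  #|B| = s.+1 ->
  (stepanov_poly F B (n + s) 0)`_n = 'C(n + s, n)%:R.
Proof.
move=> cB; rewrite coef_stepanov_poly newton_weight_exp cB; last by lia.
rewrite addn0 addKn eqxx mulr1 expr0 mulr1 -['X + 1]/('X + 1%:P) coef_XaddC_exp.
by rewrite expr1n.
Qed.

(** Here [b ^+ n = 1] lowers the exponent below [s + t]. This serves as the Taylor expansion at 0
    when 0 lies in [A] but not in [B]. *)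
Lemma coef_stepanov_poly_bottom (F : finFieldType) (B : {set F}) (n s t k : nat) :
  #|B| = (s + t).+1 -> {in B, forall b, b ^+ n = 1} -> (0 < k <= s + t)%N ->
  (stepanov_poly F B (n + s) t)`_k = 0.
Proof.
move=> cB Bn /andP[k0 kst]; rewrite coef_stepanov_poly.
rewrite (eq_bigr (fun b => newton_weight F B b * b ^+ (s + t - k))).
  rewrite newton_weight_exp cB; last by lia.
  by rewrite (_ : _ == _ = false) ?mulr0 //; lia.
move=> b bB; rewrite (_ : n + s + t - k = n + (s + t - k))%N; last by lia.
by rewrite exprD Bn // mul1r.
Qed.

(** The coefficient of [X^k] in [(X + u)^(n + s) (X + v)^t], minus the same expansion with [u^n]
    replaced by 1. *)
Definition stepanov_defect (F : comNzRingType) (n s t k : nat) (u v : F) : F :=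
  \sum_(l < k.+1) (u ^+ (n + s - l) - u ^+ (s - l)) * v ^+ (t - (k - l))
    *+ ('C(n + s, l) * 'C(t, k - l)).

Lemma stepanov_defect_root (F : comNzRingType) (n s t k : nat) (u v : F) :
  (k <= s)%N -> u ^+ n = 1 -> stepanov_defect F n s t k u v = 0.
Proof.
move=> ks un; apply: big1 => l _.
rewrite (_ : n + s - l = n + (s - l))%N; last by have := ltn_ord l; lia.
by rewrite exprD un mul1r subrr mul0r mul0rn.
Qed.

Lemma stepanov_defect_diag_lt (F : comNzRingType) (n s t k : nat) (u : F) :
  (k < t)%N -> stepanov_defect F n s t k u 0 = 0.
Proof.
move=> kt; apply: big1 => l _.
by rewrite expr0n (_ : _ == _ = false) ?mulr0 ?mul0rn //; lia.
Qed.

(** Only [l = 0] leaves [v] with exponent 0. This value decides both the nonvanishing of the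
    polynomial and the extra order of a root. *)
Lemma stepanov_defect_diag (F : comNzRingType) (n s t : nat) (u : F) :
  stepanov_defect F n s t t u 0 = u ^+ s * (u ^+ n - 1).
Proof.
rewrite /stepanov_defect big_ord_recl /= big1 ?addr0 => [|l _].
  by rewrite !subn0 subnn expr0 bin0 binn !mulr1 mulr1n addnC exprD mulrBr mulr1.
rewrite expr0n (_ : _ == _ = false) ?mulr0 ?mul0rn // /bump.
have := ltn_ord l; lia.
Qed.

Lemma size_XaddC_XsubC_exp (F : idomainType) (a : F) (i j : nat) :
  size (('X + a%:P) ^+ i * ('X - a%:P) ^+ j) = (i + j).+1.
Proof.
rewrite -{1}[a]opprK polyCN size_Mmonic; last 2 first.
- by rewrite expf_neq0 // polyXsubC_eq0.
- by rewrite monic_exp ?monicXsubC.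
by rewrite !size_exp_XsubC addnS.
Qed.

(* Where [u ^+ n = 1] for all [u = a + b], the Taylor coefficients at [a] are
   divided differences of polynomials in [b] of degree at most [s + t - k];
   [stepanov_defect] measures the failure of that substitution. *)
Lemma coef_stepanov_poly_shift (F : finFieldType) (B : {set F})
    (n s t k : nat) (a : F) : #|B| = (s + t).+1 -> (k <= s)%N ->
  (stepanov_poly F B (n + s) t \Po ('X + a%:P))`_k =
  (-1) ^+ t *+ (k == 0)%N +
  \sum_(b in B) newton_weight F B b * stepanov_defect F n s t k (a + b) (a - b).
Proof.
move=> cB ks.
pose T l : {poly F} := ('X + a%:P) ^+ (s - l) * ('X - a%:P) ^+ (t - (k - l)).
(* [Q.[b]] is the substituted Taylor coefficient at [a]; the signs turn [b - a] into [a - b]. Its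
   degree in [b] is at most [s + t - k], so its divided difference survives only for [k = 0]. *)
pose Q : {poly F} := \sum_(l < k.+1)
  ((-1) ^+ (t - (k - l)) *+ ('C(n + s, l) * 'C(t, k - l))) *: T l.
have sT (l : 'I_k.+1) : (k - l <= t)%N -> size (T l) = (s + t - k).+1.
  move=> klt; rewrite size_XaddC_XsubC_exp; have := ltn_ord l; lia.
have sQ : (size Q <= (s + t - k).+1)%N.
  apply: leq_trans (size_sum _ _ _) _; apply/bigmax_leqP => l _.
  have [tkl|klt] := ltnP t (k - l).
    by rewrite (bin_small tkl) muln0 mulr0n scale0r size_poly0.
  by rewrite -(sT l klt) size_scale_leq.
have Qb b : Q.[b] = \sum_(l < k.+1) (a + b) ^+ (s - l) * (a - b) ^+ (t - (k - l))
    *+ ('C(n + s, l) * 'C(t, k - l)).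
  rewrite horner_sum; apply: eq_bigr => l _.
  rewrite hornerZ hornerM !horner_exp hornerXsubC hornerD hornerX hornerC mulrnAl.
  congr (_ *+ _).
  by rewrite -(opprB b a) (exprNn (b - a)) mulrCA (addrC b a).
have Qtop : Q`_(s + t) = (-1) ^+ t *+ (k == 0)%N.
  have [k0|k0] := posnP k; last first.
    by rewrite mulr0n nth_default //; apply: leq_trans sQ _; lia.
  have st : (s + t)%N = (size (T 0)).-1.
    by rewrite (sT ord0) //= k0; lia.
  rewrite /Q; move: st; rewrite k0 => st; rewrite big_ord_recl big_ord0 addr0.
  rewrite coefZ {1}st -lead_coefE lead_coefM.
  by rewrite !lead_coef_exp lead_coefXsubC lead_coefXaddC !expr1n
    !mulr1 !bin0 /= !subn0.
rewrite -Qtop -[X in Q`_X]/((s + t).+1.-1) -cB -divided_difference; last first.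
  by apply: leq_trans sQ _; rewrite cB; lia.
rewrite -big_split /= raddf_sum /= coef_sum; apply: eq_bigr => b bB.
rewrite comp_polyZ coefZ comp_polyM -mulrDr; congr (_ * _).
rewrite !rmorphXn /= comp_polyB comp_polyD comp_polyX !comp_polyC.
rewrite -!addrA -polyCD -polyCB coef_XaddC_expM Qb -big_split /=.
by apply: eq_bigr => l _; rewrite -mulrnDl -mulrDl addrCA subrr addr0.
Qed.

(** * Binomial coefficients modulo [p] *)

(** Lucas' theorem at a single cut: with [P = p ^ r], Frobenius gives [(X + 1)^(n0 + P a) = (X +
    1)^n0 (X^P + 1)^a], where only the index [s0] of the first factor contributes. *)
Lemma bin_pchar_block (F : fieldType) (p r n0 s0 a b : nat) :
  p \in [pchar F] -> (n0 < p ^ r)%N -> (s0 < p ^ r)%N ->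
  'C(n0 + p ^ r * a, s0 + p ^ r * b)%:R = 'C(n0, s0)%:R * 'C(a, b)%:R :> F.
Proof.
move=> pF n0P s0P; have pp := pcharf_prime pF.
have P0 : (0 < p ^ r)%N by rewrite expn_gt0 prime_gt0.
set P := (p ^ r)%N in n0P s0P P0 *.
have cb (M l : nat) : (('X + 1) ^+ M : {poly F})`_l = 'C(M, l)%:R.
  by rewrite -['X + 1]/('X + 1%:P) coef_XaddC_exp expr1n.
have frob : ('X + 1 : {poly F}) ^+ P = ('X + 1) \Po 'X^P.
  rewrite exprDn_pchar ?expr1n; first by rewrite comp_polyD comp_polyX comp_polyC.
  rewrite /P pnatX; apply/orP; left; rewrite pnatE //.
  by rewrite pchar_poly.
rewrite -cb exprD exprM frob -rmorphXn /= coefM.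
have sO : (s0 < (s0 + P * b).+1)%N by lia.
rewrite (bigD1 (Ordinal sO)) //= big1 ?addr0 => [|l ls].
  by rewrite cb coef_comp_poly_Xn // addKn dvdn_mulr // mulKn // cb.
have [n0l|ln0] := ltnP n0 l; first by rewrite cb bin_small ?mul0r.
rewrite coef_comp_poly_Xn //; case: ifP => [dv|_]; last by rewrite mulr0.
case/eqP: ls; apply: val_inj => /=.
have lP : (l < P)%N by exact: leq_ltn_trans n0P.
move/dvdnP: dv => [c cE].
have : (b * P + s0)%N = (c * P + l)%N by have := ltn_ord l; lia.
by move/(congr1 (modn^~ P)); rewrite !modnMDl !modn_small.
Qed.

(** Pascal's rule: ['C(p ^ r, s.+1)] vanishes in [F] for [s.+1 < p ^ r], so consecutive entries are
    negatives of each other. *)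
Lemma bin_pchar_pred_exp (F : fieldType) (p r s : nat) :
  p \in [pchar F] -> (s < p ^ r)%N -> 'C((p ^ r).-1, s)%:R = (-1) ^+ s :> F.
Proof.
move=> pF; have pp := pcharf_prime pF.
have P0 : (0 < p ^ r)%N by rewrite expn_gt0 prime_gt0.
elim: s => [|s IH] sP; first by rewrite bin0.
have := @bin_pchar_block F p r 0 s.+1 1 0 pF P0 sP.
rewrite bin0n mul0r muln0 addn0 add0n muln1 -{1}(prednK P0) binS natrD.
rewrite IH 1?ltnW // => /eqP; rewrite addr_eq0 => /eqP ->.
by rewrite exprS mulN1r.
Qed.

Lemma bin_pchar_neq0 (F : fieldType) (p e u : nat) :
  p \in [pchar F] -> (e + u < p)%N -> 'C(e + u, u)%:R != 0 :> F.
Proof.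
move=> pF eup; have pp := pcharf_prime pF.
rewrite -(dvdn_pcharf pF); apply/negP => pd.
have : (p %| (e + u)`!)%N.
  by rewrite -(@bin_fact (e + u) u) ?leq_addl // dvdn_mulr.
apply/negP; elim: (e + u)%N eup => [|i IH] ip; first by rewrite Euclid_dvd1.
by rewrite factS Euclid_dvdM // negb_or gtnNdvd //= IH 1?ltnW.
Qed.

(* [s] is [N - 1] rounded down to its leading base-[p] digit, or, when that
   digit carries against the digits [(p - 1) / d] of [n], the largest number
   with the same number of digits that does not carry. *)
Lemma exists_bin_pchar_neq0 (F : fieldType) (p d k n N : nat) :
  p \in [pchar F] -> (2 <= d)%N -> (d %| p.-1)%N -> (d * n = p ^ k - 1)%N ->
  (2 <= N <= p ^ k)%N ->
  exists s, [/\ (s < N)%N, (N <= s.*2.+1)%N & 'C(n + s, n)%:R != 0 :> F].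
Proof.
move=> pF d2 dp dn /andP[N2 Nq]; have pp := pcharf_prime pF.
have p1 := prime_gt1 pp.
(* [rep j] has [j] base-[p] digits, all equal to [(p - 1) / d]. *)
pose rep j := ((p ^ j - 1) %/ d)%N.
have repE j : (d * rep j = p ^ j - 1)%N.
  rewrite mulnC divnK //.
  elim: j => [|j IH]; first by rewrite expn0.
  rewrite expnS.
  rewrite (_ : p * p ^ j - 1 = p.-1 * p ^ j + (p ^ j - 1))%N.
    by rewrite dvdn_add ?dvdn_mulr.
  have : (0 < p ^ j)%N by rewrite expn_gt0 prime_gt0.
  case: (p) p1 => // p' _; rewrite mulSn /=; lia.
have repD i j : rep (i + j)%N = (rep i + p ^ i * rep j)%N.
  apply/eqP; rewrite -(@eqn_pmul2l d); last by lia.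
  rewrite mulnDr mulnCA !repE expnD mulnBr muln1; apply/eqP.
  have : (0 < p ^ i)%N by rewrite expn_gt0 prime_gt0.
  have : (0 < p ^ j)%N by rewrite expn_gt0 prime_gt0.
  nia.
have repn : n = rep k.
  by apply/eqP; rewrite -(@eqn_pmul2l d) ?repE ?dn //; lia.
have rep_lt j : (rep j < p ^ j)%N.
  have : (0 < p ^ j)%N by rewrite expn_gt0 prime_gt0.
  have := repE j; nia.
pose r := trunc_log p N.-1.
have N1 : (0 < N.-1)%N by lia.
have /andP[rlo rhi] := trunc_log_bounds p1 N1; rewrite -/r in rlo rhi.
have rk : (r < k)%N.
  by rewrite -(ltn_exp2l _ _ p1); apply: leq_ltn_trans rlo _; lia.
set P := (p ^ r)%N in rlo.
have P0 : (0 < P)%N by rewrite expn_gt0 prime_gt0.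
set P' := (p ^ r.+1)%N in rhi.
have [hs|hs] := leqP (P' - 1 - rep r.+1) N.-1.
  (* This [s] fills the lowest [r + 1] digits of [n] up to [p - 1]. Since [d >= 2], [rep r.+1] is at
     most [(P' - 1) / 2], so [2 s + 1 >= P' >= N]. *)
  exists (P' - 1 - rep r.+1)%N; split; first by lia.
    have := repE r.+1; rewrite -/P'; nia.
  have nE : n = (rep r.+1 + P' * rep (k - r.+1))%N by rewrite repn -repD subnKC.
  rewrite -bin_sub ?leq_addr // addKn {1}nE.
  have -> : (rep r.+1 + P' * rep (k - r.+1) + (P' - 1 - rep r.+1)
    = P'.-1 + P' * rep (k - r.+1))%N by have := rep_lt r.+1; rewrite -/P'; lia.
  have h1 : (P'.-1 < P')%N by lia.
  have h2 : (P' - 1 - rep r.+1 < P')%N by lia.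
  have := @bin_pchar_block F p r.+1 _ _ (rep (k - r.+1)%N) 0 pF h1 h2.
  rewrite -/P' muln0 addn0 => ->.
  by rewrite bin0 mulr1 bin_pchar_pred_exp -/P' ?signr_eq0 //; lia.
pose u := (N.-1 %/ P)%N.
have uP : (u * P <= N.-1)%N by exact: leq_trunc_div.
have uP' : (N.-1 < u.+1 * P)%N by rewrite ltn_ceil.
have u1 : (0 < u)%N by rewrite divn_gt0.
pose e := rep 1.
have eE : (d * e = p - 1)%N by rewrite /e repE expn1.
have r1 : rep r.+1 = (rep r + P * e)%N by rewrite -addn1 repD.
have P'E : P' = (p * P)%N by rewrite /P' expnS.
(* A carry would force [(e + u) P >= P'], against [hs]. *)
have up : (e + u < p)%N.
  have := rep_lt r; rewrite -/P => rl; rewrite ltnNge; apply/negP => pl.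
  have : ((p * P) <= (e + u) * P)%N by rewrite leq_mul2r pl orbT.
  rewrite mulnDl; move: hs; rewrite r1 P'E (mulnC P e); lia.
have Pu : (P <= u * P)%N by exact: leq_pmull.
rewrite mulSn in uP'; exists (u * P)%N; split; [lia | lia |].
rewrite -bin_sub ?leq_addr // addKn.
have -> : (n + u * P = rep r + P * (rep (k - r) + u))%N.
  by rewrite mulnDr addnA -repD subnKC 1?ltnW // -repn mulnC.
have := @bin_pchar_block F p r (rep r) 0 (rep (k - r)%N + u) u pF (rep_lt r) P0.
rewrite add0n -/P (mulnC P u) => ->; rewrite bin0 mul1r.
have -> : (rep (k - r) + u = e + u + p ^ 1 * rep (k - r).-1)%N.
  have -> : rep (k - r)%N = rep (1 + (k - r).-1)%N by congr rep; lia.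
  by rewrite repD addnAC.
have h1 : (e + u < p ^ 1)%N by rewrite expn1.
have h2 : (u < p ^ 1)%N by rewrite expn1; lia.
have := @bin_pchar_block F p 1 _ _ (rep (k - r)%N.-1) 0 pF h1 h2.
rewrite muln0 addn0 => ->.
by rewrite bin0 mulr1 (bin_pchar_neq0 _ _ _ _ pF).
Qed.

(** * Bounds from counting roots *)

Lemma subset_of_card (T : finType) (A : {set T}) (m : nat) :
  (m <= #|A|)%N -> exists2 B : {set T}, B \subset A & #|B| = m.
Proof.
move=> mA; exists [set x in take m (enum A)].
  by apply/subsetP => x; rewrite inE => /mem_take; rewrite mem_enum.
have /card_uniqP : uniq (take m (enum A)) by rewrite take_uniq ?enum_uniq.
by rewrite cardsE size_takel -?cardE.
Qed.

Lemma full_sumset_bound (F : finFieldType) (A : {set F}) (n s : nat) :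
  (0 < n)%N -> (0 < s < #|A|)%N -> 'C(n + s, n)%:R != 0 :> F ->
  {in A &, forall a b, a != b -> (a + b) ^+ n = 1} ->
  {in A, forall a, a != 0 -> (a + a) ^+ n = 1} ->
  (#|A| * s.+1 <= n.+1)%N.
Proof.
move=> n0 /andP[s0 sA] C0 hA hdiag.
have [B BA cB] := subset_of_card _ _ _ sA.
have cB' : #|B| = (s + 0).+1 by rewrite addn0.
pose g : {poly F} := stepanov_poly F B (n + s) 0 - 1%:P.
have g0 : g != 0.
  apply: contraNneq C0 => gz; have := coef_stepanov_poly_top F B n s cB.
  rewrite -[stepanov_poly _ _ _ _](subrK 1%:P) -/g gz add0r coefC gtn_eqF //.
  by move=> <-.
have sg : (size g <= n.+1)%N.
  apply: leq_trans (size_polyD _ _) _; rewrite geq_max size_polyN size_poly1.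
  by rewrite (size_stepanov_poly F B n s 0) ?addn0.
(* At 0 the diagonal term with [l = s] contains [0 ^+ 0] and need not cancel, so only order [s] is
   claimed there; this loss is the 1 added to [n] in the bound. *)
pose mu (a : F) := (s.+1 - (a == 0%R))%N.
have : (\sum_(a in A) mu a < size g)%N.
  apply: sum_multiplicities_lt_size => // a i aA; rewrite /mu => imu.
  rewrite comp_polyB comp_polyC coefB (coef_stepanov_poly_shift F B n s 0) //;
    last by move: imu; lia.
  rewrite big1 => [|b bB].
    by rewrite addr0 coefC expr0; case: (i == 0)%N; rewrite ?subrr ?subr0.
  have bA := subsetP BA b bB.
  have [ab|ab] := eqVneq a b; last first.
    rewrite stepanov_defect_root ?mulr0 ?hA //; by move: imu; lia.
  rewrite -ab; have [az|anz] := eqVneq a 0; last first.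
    rewrite stepanov_defect_root ?mulr0 ?hdiag //; by move: imu; lia.
  rewrite /stepanov_defect big1 ?mulr0 // => l _; rewrite az addr0.
  rewrite !expr0n; move: imu; rewrite az eqxx => imu.
  have sl : (0 < s - l)%N by have := ltn_ord l; lia.
  have nsl : (0 < n + s - l)%N by lia.
  by rewrite !gtn_eqF // subrr mul0r mul0rn.
move=> h; have {}h : (\sum_(a in A) mu a <= n)%N by lia.
have : (\sum_(a in A) (mu a + (a == 0%R)) = #|A| * s.+1)%N.
  by rewrite -sum_nat_const; apply: eq_bigr => a _; rewrite subnK //; case: eqP.
rewrite big_split /= => <-; rewrite -addn1 leq_add //.
rewrite (eq_bigr (fun a => if a == 0%R then 1 else 0)%N); last first.
  by move=> a _; case: eqP.
rewrite -big_mkcondr /= sum1dep_card.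
rewrite -(cards1 (0 : F)) subset_leq_card //.
by apply/subsetP => a; rewrite !inE => /andP[].
Qed.

(** A guaranteed order of vanishing of [f - (-1)^m] at [a]; the true one may be larger. *)
Definition root_order (F : finFieldType) (B : {set F}) (n m : nat) (a : F) : nat :=
  if a \in B then (m + ((a == 0%R) || ((a + a) ^+ n == 1)%R))%N
  else if a == 0%R then m.*2.+1 else m.+1.

Lemma restricted_sumset_bound (F : finFieldType) (A B : {set F}) (n m : nat)
    (b0 : F) :
  (0 < n)%N -> (0 < m)%N -> B \subset A -> #|B| = m.*2.+1 ->
  {in A &, forall a b, a != b -> (a + b) ^+ n = 1} ->
  b0 \in B -> b0 + b0 != 0 -> (b0 + b0) ^+ n != 1 ->
  (\sum_(a in A) root_order F B n m a <= n)%N.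
Proof.
move=> n0 m0 BA cB hA b0B b00 b0n.
have cB' : #|B| = (m + m).+1 by rewrite addnn.
pose g : {poly F} := stepanov_poly F B (n + m) m - ((-1) ^+ m)%:P.
have shift a k : (k <= m)%N -> (g \Po ('X + a%:P))`_k = \sum_(b in B)
    newton_weight F B b * stepanov_defect F n m m k (a + b) (a - b).
  move=> km; rewrite comp_polyB comp_polyC coefB.
  rewrite (coef_stepanov_poly_shift F B n m m) // coefC.
  by case: (k == 0)%N; rewrite ?mulr0n ?mulr1n ?subr0 ?add0r // addrC addKr.
(* For [a] in [A] all terms with [b <> a] vanish, leaving the diagonal one. *)
have shiftA a k : a \in A -> (k <= m)%N -> (g \Po ('X + a%:P))`_k =
    if a \in B then newton_weight F B a * stepanov_defect F n m m k (a + a) 0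
    else 0.
  move=> aA km; rewrite shift //.
  have off b : b \in B -> b != a ->
      newton_weight F B b * stepanov_defect F n m m k (a + b) (a - b) = 0.
    move=> bB ba; rewrite stepanov_defect_root ?mulr0 // hA 1?eq_sym //.
    exact: (subsetP BA).
  case: ifPn => aB.
    rewrite (bigD1 a) //= subrr big1 ?addr0 // => b /andP[]; exact: off.
  apply: big1 => b bB; apply: off => //; by apply: contraNneq aB => <-.
have g0 : g != 0.
  apply/eqP => gz; have := shiftA b0 m (subsetP BA _ b0B) (leqnn m).
  rewrite gz comp_poly0 coef0 b0B stepanov_defect_diag => /esym/eqP.
  rewrite !mulf_eq0 (negPf (newton_weight_neq0 _ _ _)) expf_eq0 (negPf b00).
  by rewrite andbF subr_eq0 (negPf b0n).
have sg : (size g <= n.+1)%N.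
  apply: leq_trans (size_polyD _ _) _; rewrite geq_max size_polyN.
  rewrite size_polyC (leq_trans (leq_b1 _)) // andbT.
  by rewrite (size_stepanov_poly F B n m m) // addn_gt0 m0.
suff : (\sum_(a in A) root_order F B n m a < size g)%N by lia.
apply: sum_multiplicities_lt_size => // a i aA; rewrite /root_order.
have [aB|aB] := ifPn.
  have [im _|mi] := ltnP i m.
    by rewrite shiftA ?aB 1?ltnW // stepanov_defect_diag_lt ?mulr0.
  case: (boolP (_ || _)) => hyp iE; last by move: iE; lia.
  have -> : i = m by move: iE; lia.
  rewrite shiftA // aB stepanov_defect_diag.
  case/orP: hyp => /eqP ->; last by rewrite subrr !mulr0.
  by rewrite addr0 expr0n eqn0Ngt m0 mul0r mulr0.
case: eqP => [a0|_] im; last by rewrite shiftA // (negPf aB).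
have [im'|mi] := leqP i m; first by rewrite shiftA // (negPf aB).
(* The shifted formula stops at order [m]; at 0 the higher coefficients are read off directly. *)
rewrite a0 addr0 comp_polyXr coefB coefC.
have i0 : (0 < i)%N by lia.
rewrite (coef_stepanov_poly_bottom F B n m m) // ?gtn_eqF ?subrr //; last by lia.
move=> b bB; rewrite -[b]add0r; apply: hA; rewrite -?a0 //.
  exact: (subsetP BA).
by apply: contraNneq aB => ->.
Qed.

(** * Power residues, pairs of indices, and bounds on the size of [A] *)

Lemma expf_power_residue (F : finFieldType) (d n : nat) (x : F) :
  (d * n = #|F| - 1)%N -> x \in power_residues F d -> x ^+ n = 1.
Proof.
move=> dn /imsetP[y]; rewrite inE => y0 ->; rewrite -exprM dn.
apply: (mulIf y0); rewrite mul1r -exprSr subn1 prednK ?expf_card //.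
by apply/card_gt0P; exists 0.
Qed.

(** Each fibre of [x ^+ d] consists of roots of [X^d - y], so it has at most [d] elements. *)
Lemma card_power_residues_ge (F : finFieldType) (d n : nat) :
  (0 < d)%N -> (d * n = #|F| - 1)%N -> (n <= #|power_residues F d|)%N.
Proof.
move=> d0 dn; rewrite -(leq_pmul2l d0) dn.
have -> : (#|F| - 1)%N = #|[set y : F | y != 0]|.
  by rewrite cardsE subn1 -(cardC1 (0 : F)); apply: eq_card.
rewrite -sum1_card (partition_big_imset (fun x : F => x ^+ d)) /=.
rewrite mulnC -sum_nat_const; apply: leq_sum => y _.
rewrite sum1dep_card cardE -ltnS -(@size_XnsubC F d y d0).
apply: max_poly_roots; last exact: enum_uniq.
  by rewrite -size_poly_eq0 size_XnsubC.
apply/allP => x; rewrite mem_enum inE => /andP[_ /eqP xd].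
by rewrite rootE !hornerE xd subrr.
Qed.

Definition increasing_pairs (N : nat) : {set 'I_N * 'I_N} :=
  [set ij : 'I_N * 'I_N | (ij.1 < ij.2)%N].

Lemma card_increasing_pairs (N : nat) : #|increasing_pairs N| = 'C(N, 2).
Proof.
rewrite -bin2_sum big_mkord -sum1_card 
  (eq_bigl (fun ij : 'I_N * 'I_N => true && (ij.1 < ij.2)%N));
  last by move=> ij; rewrite inE.
rewrite -(pair_big_dep xpredT (fun i j : 'I_N => (i < j)%N) (fun _ _ => 1%N)) /=.
rewrite (exchange_big_dep xpredT) //=; apply: eq_bigr => j _.
rewrite -[RHS]card_ord -sum1_card.
rewrite (big_ord_narrow (F := fun _ => 1%N)) //; exact: ltnW.
Qed.

(** Each unordered pair is counted once, so a cardinality of ['C(#|A|, 2)] will force the sums to be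
    distinct. *)
Lemma restricted_sumsetE (F : finFieldType) (A : {set F}) :
  restricted_sumset A =
  [set enum_val ij.1 + enum_val ij.2 | ij in increasing_pairs #|A|].
Proof.
apply/setP => x; apply/imset2P/imsetP => [[a b aA]|[[i j]]].
  rewrite inE => /andP[bA ab] ->.
  set i := enum_rank_in aA a; set j := enum_rank_in aA b.
  have ia : enum_val i = a by rewrite enum_rankK_in.
  have jb : enum_val j = b by rewrite enum_rankK_in.
  have [ij|ji|/val_inj ij] := ltngtP i j.
  - by exists (i, j); rewrite ?inE //= ia jb.
  - by exists (j, i); rewrite ?inE //= ia jb addrC.
  - by case/eqP: ab; rewrite -ia -jb ij.
rewrite inE /= => ij ->; exists (enum_val i) (enum_val j); rewrite ?enum_valP //.
rewrite inE enum_valP /=; apply: contraTneq ij => /enum_val_inj ->.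
by rewrite ltnn.
Qed.

Lemma pchar_natr2_neq0 (F : finFieldType) (d p k : nat) :
  (2 <= d)%N -> prime p -> (d %| p.-1)%N -> #|F| = (p ^ k)%N ->
  2%:R != 0 :> F.
Proof.
move=> d2 pp dp cF; rewrite -(dvdn_pcharf (card_finPcharP cF pp)) dvdn_prime2 //.
by apply: contraTneq dp => ->; rewrite dvdn1 gtn_eqF.
Qed.

Lemma restricted_sumset_card_bounds (F : finFieldType) (d p k n : nat)
    (A : {set F}) :
  (2 <= d)%N -> prime p -> (d %| p.-1)%N -> #|F| = (p ^ k)%N ->
  (d * n = p ^ k - 1)%N -> (3 <= n)%N ->
  restricted_sumset A = power_residues F d ->
  [/\ (n <= 'C(#|A|, 2))%N,
      odd #|A| \/ 0 \in A ->
        ('C(#|A|, 2) <= n)%N /\ {in A, forall a, (a + a) ^+ n != 1}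
    & ~~ odd #|A| -> ((#|A| - 1) ^ 2 < n * 2)%N].
Proof.
move=> d2 pp dp cF dn n3 hA.
have pF : p \in [pchar F] := card_finPcharP cF pp.
have d0 : (0 < d)%N by lia.
have dn' : (d * n = #|F| - 1)%N by rewrite cF.
have n0 : (0 < n)%N by lia.
have two := pchar_natr2_neq0 F d p k d2 pp dp cF.
have dbl (a : F) : (a + a == 0) = (a == 0).
  by rewrite -mulr2n -mulr_natl mulf_eq0 (negPf two).
have hAn : {in A &, forall a b, a != b -> (a + b) ^+ n = 1}.
  move=> a b aA bA ab; apply: (expf_power_residue F d n) => //; rewrite -hA.
  by apply/imset2P; exists a b; rewrite // inE bA.
have nC : (n <= 'C(#|A|, 2))%N.
  rewrite -card_increasing_pairs.
  apply: leq_trans (card_power_residues_ge F d n d0 dn') _.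
  by rewrite -hA restricted_sumsetE leq_imset_card.
have N3 : (3 <= #|A|)%N.
  rewrite ltnNge; apply/negP => /(leq_bin2l 2); rewrite binn; lia.
have [b0 b0A /andP[b00 b0n]] :
    exists2 b, b \in A & (b + b != 0) && ((b + b) ^+ n != 1).
  apply/exists_inP; apply: contraT; rewrite negb_exists_in => /forall_inP hall.
  have [|s [sN Ns sC]] := exists_bin_pchar_neq0 F p d k n #|A| pF d2 dp dn.
    by rewrite -cF max_card andbT; lia.
  have s0 : (0 < s < #|A|)%N by lia.
  have := full_sumset_bound F A n s n0 s0 sC hAn.
  have hd : {in A, forall a, a != 0 -> (a + a) ^+ n = 1}.
    by move=> a aA a0; have := hall a aA; rewrite dbl a0 /= negbK => /eqP.
  move=> /(_ hd).
  (* As [s + 1 >= (N + 1) / 2], this gives [N (N + 1) / 2 <= n + 1 <= N (N - 1) / 2 + 1], that is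
     [N <= 1]. *)
  move: nC; rewrite bin2 -divn2; nia.
have b0z : b0 != 0 by rewrite -dbl.
have key := restricted_sumset_bound F A _ n _ b0 n0 _ _ _ hAn _ b00 b0n.
(* The extra order at points of [B]. Once the other orders already sum to ['C(#|A|, 2) >= n], no
   room is left for it. *)
pose dlt (a : F) : nat := ((a == 0) || ((a + a) ^+ n == 1)).
have dltP (B : {set F}) : (\sum_(a in B) dlt a <= 0)%N ->
    {in B, forall a, (a + a) ^+ n != 1}.
  rewrite leqn0 sum_nat_eq0 => /forall_inP H a aB.
  by have := H a aB; rewrite /dlt; case: (_ == 1); rewrite ?orbT.
have sumB (B : {set F}) m : #|B| = m.*2.+1 ->
    (\sum_(a in B) root_order F B n m a = m.*2.+1 * m + \sum_(a in B) dlt a)%N.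
  move=> <-; rewrite -sum_nat_const -big_split /=; apply: eq_bigr => a aB.
  by rewrite /root_order aB.
pose m := (#|A|.-1)./2.
have m0 : (0 < m)%N by rewrite /m half_gt0; case: #|A| N3 => [|[|[]]].
split=> //.
  move=> hor; have [oN|eN] := boolP (odd #|A|).
    have cA : #|A| = m.*2.+1 by move: oN N3; rewrite /m; clear; lia.
    have := key A m m0 (subxx A) cA b0A; rewrite sumB //.
    have CE : 'C(#|A|, 2) = (m.*2.+1 * m)%N by rewrite bin2odd // cA /= doubleK.
    rewrite CE in nC *; move=> h; split; first exact: leq_trans (leq_addr _ _) h.
    apply: dltP; rewrite -(leq_add2l (m.*2.+1 * m)) addn0.
    exact: leq_trans h nC.
  have zA : 0 \in A by case: hor; rewrite // (negPf eN).
  have cA : #|A| = m.*2.+2 by move: eN N3; rewrite /m; clear; lia.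
  have cB : #|A :\ 0| = m.*2.+1.
    by apply: succn_inj; rewrite -cA (cardsD1 0 A) zA.
  have b0B : b0 \in A :\ 0 by rewrite !inE b0z.
  have := key (A :\ 0) m m0 (subsetDl _ _) cB b0B.
  rewrite (big_setD1 0) //= sumB // {1}/root_order !inE eqxx /=.
  have CE : 'C(#|A|, 2) = (m.*2.+1 * m.+1)%N.
    by rewrite bin2 cA -[_.-1]/(m.*2.+1) -doubleS -doubleMl doubleK mulnC.
  rewrite CE mulnS in nC *; rewrite addnA => h; split.
    exact: leq_trans (leq_addr _ _) h.
  move=> a aA; have [->|a0] := eqVneq a 0.
    by rewrite addr0 expr0n gtn_eqF // eq_sym oner_eq0.
  apply: (dltP (A :\ 0)); last by rewrite !inE a0.
  rewrite -(leq_add2l (m.*2.+1 + m.*2.+1 * m)) addn0.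
  exact: leq_trans h nC.
move=> eN; have cA : #|A| = m.*2.+2 by move: eN N3; rewrite /m; clear; lia.
(* The removed point differs from [b0], which must stay in [B]. *)
have [a1] : exists a, a \in A :\ b0.
  by apply/card_gt0P; have := cardsD1 b0 A; rewrite b0A cA; case: #|A :\ b0|.
rewrite !inE => /andP[ab a1A].
have cB : #|A :\ a1| = m.*2.+1.
  by apply: succn_inj; rewrite -cA (cardsD1 a1 A) a1A.
have b0B : b0 \in A :\ a1 by rewrite !inE eq_sym ab.
have := key (A :\ a1) m m0 (subsetDl _ _) cB b0B.
rewrite (big_setD1 a1) //= sumB // {1}/root_order !inE eqxx /= cA.
(* The point [a1] contributes at least [m + 1], so [n >= 2 m^2 + 2 m + 1] and
   [2 n >= (2 m + 1)^2 + 1]. *)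
rewrite subn1 /= -mulnn; move: (\sum_(i in _) _)%N => S.
by case: ifP => _; clear; nia.
Qed.

(** * From the bounds to the Sidon property and the fractional part *)

Lemma natr_bin2 (R : nzRingType) (N : nat) :
  2 * 'C(N, 2)%:R = N%:R * (N%:R - 1) :> R.
Proof.
case: N => [|N]; first by rewrite bin0n mulr0 mul0r.
have E := mul_bin_diag N.+1 1; rewrite bin1 in E.
by rewrite -natrM -E natrM -[in X in _ * (X - 1)]natr1 addrK.
Qed.

(** Dividing by 4: [(h - 1/2)^2 < n / 2 <= h^2 - h / 2 < (h - 1/4)^2]. *)
Lemma half_sqrt_bounds (R : realType) (n h : nat) :
  (0 < h)%N -> ((h.*2 - 1) ^ 2 < n * 2)%N -> (n <= 'C(h.*2, 2))%N ->
  h%:R - 1 / 2 < Num.sqrt (n%:R / 2 : R) < h%:R - 1 / 4.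
Proof.
move=> h0 lo hi.
have h2 : h.*2%:R = h%:R * 2 :> R by rewrite -muln2 natrM.
have {}lo : (h%:R * 2 - 1) ^+ 2 < n%:R * 2 :> R.
  by rewrite -h2 -(natrB R (n := 1)) ?double_gt0 // -natrX -natrM ltr_nat.
have {}hi : n%:R * 2 <= h%:R * 2 * (h%:R * 2 - 1) :> R.
  by rewrite -h2 -natr_bin2 mulrC ler_pM2l ?ler_nat.
have n0 : 0 <= n%:R / 2 :> R by rewrite divr_ge0 ?ler0n.
have h1 : 1 <= h%:R :> R by rewrite ler1n.
have := sqr_sqrtr n0; have := sqrtr_ge0 (n%:R / 2 : R).
move: (Num.sqrt _) => x x0 xE.
by apply/andP; split; rewrite ltNge; apply/negP => hx; nra.
Qed.

Theorem theorem1p4 (R : realType) (d p k q : nat) (F : finFieldType)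
    (A : {set F})
    (hd : (2 <= d)%N) (hp : prime p) (hpd : p = 1 %[mod d])
    (hk : (0 < k)%N) (hq : q = (p ^ k)%N) (hF : #|F| = q)
    (hqd : 3 <= (q%:R - 1) / d%:R :> R)
    (hA : restricted_sumset A = power_residues F d) :
  (odd #|A| \/ 0 \in A ->
     [/\ sidon A,
         [set a *+ 2 | a in A] :&: power_residues F d = set0
       & q%:R = d%:R * #|A|%:R * (#|A|%:R - 1) / 2 + 1 :> R]) /\
  (~~ odd #|A| ->
     (#|A|%:Z = 2 * Num.ceil (Num.sqrt ((q%:R - 1) / (2 * d%:R) : R))) /\
     (1 / 2 < frac_part (Num.sqrt ((q%:R - 1) / (2 * d%:R) : R)) < 3 / 4)).
Proof.
have d0 : (0 < d)%N by exact: ltnW.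
have q0 : (0 < q)%N by rewrite hq expn_gt0 prime_gt0.
have dp : (d %| p.-1)%N.
  by rewrite -subn1 -eqn_mod_dvd ?prime_gt0 //; apply/eqP.
have /dvdnP[n qE] : (d %| q - 1)%N.
  by rewrite -eqn_mod_dvd // hq -modnXm hpd modnXm exp1n.
have {}qE : (d * n = q - 1)%N by rewrite qE mulnC.
have dR : d%:R != 0 :> R by rewrite pnatr_eq0 -lt0n.
have qR : q%:R = d%:R * n%:R + 1 :> R.
  by rewrite -natrM qE natrB // subrK.
have n3 : (3 <= n)%N.
  by rewrite -(ler_nat R); move: hqd; rewrite qR addrK mulrC mulKf.
have cF : #|F| = (p ^ k)%N by rewrite hF.
have dn : (d * n = p ^ k - 1)%N by rewrite -hq.
have dnF : (d * n = #|F| - 1)%N by rewrite hF.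
have [nC hodd heven] :=
  restricted_sumset_card_bounds F d p k n A hd hp dp cF dn n3 hA.
split=> [/hodd[Cn dbl]|/[dup] eA /heven lo].
  have CE : n = 'C(#|A|, 2) by apply/eqP; rewrite eqn_leq nC Cn.
  have dblS a : a \in A -> a + a \notin power_residues F d.
    by move=> aA; apply: contra (dbl a aA) => /(expf_power_residue F d n _ dnF) ->.
  (* The ['C(#|A|, 2) = n] pairs map onto a set of at least [n] elements. *)
  have inj : {in increasing_pairs #|A| &, injective (fun ij : 'I_#|A| * 'I_#|A| =>
      enum_val ij.1 + enum_val ij.2)}.
    apply/imset_injP; rewrite -restricted_sumsetE hA card_increasing_pairs -CE.
    rewrite eqn_leq card_power_residues_ge // andbT.
    by rewrite -hA restricted_sumsetE CE -card_increasing_pairs leq_imset_card.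
  have two := pchar_natr2_neq0 F d p k hd hp dp cF.
  have mixed (i k' l : 'I_#|A|) : (k' < l)%N ->
      enum_val i + enum_val i <> enum_val k' + enum_val l.
    move=> kl E; have := dblS _ (enum_valP i); rewrite E -hA restricted_sumsetE.
    by case/imsetP; exists (k', l); rewrite ?inE.
  split.
  - move=> i j k' l; rewrite leq_eqVlt (leq_eqVlt k').
    case/predU1P=> [/val_inj<-|ij]; case/predU1P=> [/val_inj<-|kl] E.
    + move: E => /eqP; rewrite -!mulr2n -subr_eq0 -mulrnBl -mulr_natl mulf_eq0.
      by rewrite (negPf two) subr_eq0 => /eqP/enum_val_inj->.
    + by case: (mixed i k' l kl).
    + by case: (mixed k' i j ij).
    + by have := inj (i, j) (k', l); rewrite !inE /= => /(_ ij kl E) [-> ->].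
  - apply/setP => x; rewrite !inE; apply/negP => /andP[/imsetP[a aA ->]].
    by rewrite mulr2n (negPf (dblS a aA)).
  - by rewrite qR CE -(mulrA d%:R) -natr_bin2; field.
pose h := #|A|./2.
have Ah : #|A| = h.*2 by rewrite -[LHS]odd_double_half (negPf eA).
have h0 : (0 < h)%N.
  by rewrite -double_gt0 -Ah; move: (leq_trans n3 nC); case: #|A|.
have -> : (q%:R - 1) / (2 * d%:R) = n%:R / 2 :> R.
  by rewrite qR addrK; field.
rewrite Ah in nC lo; have := half_sqrt_bounds R n h h0 lo nC.
move: (Num.sqrt _) => x /andP[xlo xhi].
(* Since [h - 1/2 < x < h - 1/4], the fractional part is [x - h + 1]. *)
have fl : Num.floor x = h%:Z - 1.
  apply: floor_def; rewrite subrK intrB -!pmulrn; apply/andP; split; lra.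
have ce : Num.ceil x = h%:Z.
  apply: ceil_def; rewrite intrB -!pmulrn; apply/andP; split; lra.
split; first by rewrite ce Ah -muln2 PoszM mulrC.
rewrite /frac_part fl intrB -!pmulrn; apply/andP; split; lra.
Qed.
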